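(* Let $A^*\in\mathbb{R}_+^{n\times m}$ have all rows of $\ell_1$-norm $1$, let $B^*\in\mathbb{R}^{q\times p}$, and let $M_t=A^*X_tB^*$ for $t\in\{1,\dots,T\}$, where the design matrices $X_1,\dots,X_T$ form a generating (spanning) family of $\mathbb{R}^{m\times q}$. Let $\mathbb{C}\in\mathbb{R}^{mq\times np}$ be the matrix whose rows are the vectors $\mathrm{vec}(A^*E_{(k,l)}B^* )^\top$, $k\in[m]$, $l\in[q]$. Let $\mathcal{D}_0\subset[p]\times[q]$ denote the set of indices $(j,l)$ such that $[B^*]_{lj}\neq0$, and let $\mathcal{F}:=[n]\times[m]$. Then the entries of the matrices $A^*$ and $B^*$ can be expressed, for all $(i,k)\in[n]\times[m]$ and all $(l,j)\in[q]\times[p]$, as $$[A^*]_{ik}=\frac{\sum_{(j',l')\in\mathcal{D}_0}[\mathbb{C}]_{(k,l')}^{(i,j')}}{\sum_{(j',l')\in\mathcal{D}_0}[B^*]_{l'j'}},\qquad [B^*]_{lj}=\frac1n\sum_{(i',k')\in\mathcal{F}}[\mathbb{C}]_{(k',l)}^{(i',j)}.$$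
   Context: $[N]=\{1,\dots,N\}$; $\mathrm{vec}(\cdot)$ denotes column-wise vectorization; $E_{(k,l)}\in\mathbb{R}^{m\times q}$ is the canonical basis matrix with entry $1$ at position $(k,l)$ and $0$ elsewhere. The row of $\mathbb{C}$ indexed by $(k,l)$ is row number $k+(l-1)m$, and $[\mathbb{C}]_{(k,l)}^{(i,j)}$ denotes the entry of $\mathbb{C}$ in row $k+(l-1)m$ and column $i+(j-1)n$, so that $[\mathbb{C}]_{(k,l)}^{(i,j)}=[A^*]_{ik}[B^*]_{lj}$.
   Formalization: The formula for [A*]_{ik} is stated only when the sum of [B*]_{l'j'} over D_0 is nonzero; this sum can vanish (for example B* = (1, -1) or B* = 0), and the quotient is then undefined. Also n ≥ 1 is assumed so that 1/n makes sense. *)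

(* Defs.v *)
From mathcomp Require Import all_boot all_order all_algebra.
From mathcomp Require Import reals.

Set Implicit Arguments.
Unset Strict Implicit.
Unset Printing Implicit Defensive.

Import Order.TTheory GRing.Theory Num.Theory.
Local Open Scope ring_scope.

(* [mxvec] stacks rows, so column-wise vectorization is [mxvec] of the
   transpose; this is also why the dimension reads [p * n]. *)
Definition vec (R : Type) (n p : nat) (M : 'M[R]_(n, p)) : 'cV[R]_(p * n) :=
  (mxvec M^T)^T.

Definition vec_index (n p : nat) (i : 'I_n) (j : 'I_p) : 'I_(p * n) :=
  mxvec_index j i.

Definition vec_unindex (n p : nat) (r : 'I_(p * n)) : 'I_n * 'I_p :=
  let ji : 'I_p * 'I_n := enum_val (cast_ord (esym (mxvec_cast p n)) r) in
  (ji.2, ji.1).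

(* With 1-based indices this is position i + (j - 1) n. *)
Lemma vec_indexE (n p : nat) (i : 'I_n) (j : 'I_p) :
  vec_index i j = (i + j * n)%N :> nat.
Proof.
rewrite /vec_index /mxvec_index /= /enum_rank enum_rank_in.unlock insubdK.
  have ijE s : j \in s ->
      index (j, i) [seq (x, y) | x <- s, y <- enum 'I_n] = (i + index j s * n)%N.
    elim: s => //= x s IH; rewrite inE index_cat size_map size_enum_ord.
    rewrite eq_sym; case: eqVneq => [-> _|nxj /= /IH ->].
      rewrite map_f ?mem_enum // index_map; last by move=> ? ? [].
      by rewrite index_enum_ord addn0.
    rewrite ifN ?mulSn; first by rewrite addnCA.
    by apply/mapP=> -[y _ [E _]]; rewrite E eqxx in nxj.
  by rewrite enumT unlock /= /prod_enum ijE ?mem_enum // index_enum_ord.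
by rewrite -topredE /= cardE index_mem mem_enum.
Qed.

Lemma vec_indexK (n p : nat) (i : 'I_n) (j : 'I_p) :
  vec_unindex (vec_index i j) = (i, j).
Proof. by rewrite /vec_unindex /vec_index cast_ordK enum_rankK. Qed.

Lemma vecE (R : Type) (n p : nat) (M : 'M[R]_(n, p)) i j :
  vec M (vec_index i j) 0 = M i j.
Proof. by rewrite mxE mxvecE mxE. Qed.

Definition Cmx (R : realType) (n m q p : nat)
    (A : 'M[R]_(n, m)) (B : 'M[R]_(q, p)) : 'M[R]_(q * m, p * n) :=
  \matrix_(r < q * m)
    let kl := vec_unindex r in (vec (A *m delta_mx kl.1 kl.2 *m B))^T.

Lemma row_Cmx (R : realType) (n m q p : nat)
    (A : 'M[R]_(n, m)) (B : 'M[R]_(q, p)) (k : 'I_m) (l : 'I_q) :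
  row (vec_index k l) (Cmx A B) = (vec (A *m delta_mx k l *m B))^T.
Proof. by rewrite rowK vec_indexK. Qed.

(* [C]_{(k,l)}^{(i,j)} *)
Definition Centry (R : realType) (n m q p : nat) (C : 'M[R]_(q * m, p * n))
    (k : 'I_m) (l : 'I_q) (i : 'I_n) (j : 'I_p) : R :=
  C (vec_index k l) (vec_index i j).

(* Pairs are (j, l), so the order is transposed with respect to [B l j]. *)
Definition D0 (R : realType) (q p : nat) (B : 'M[R]_(q, p)) :
    {set 'I_p * 'I_q} :=
  [set d | B d.2 d.1 != 0].

(* Main.v *)
Require Import Defs.
From mathcomp Require Import all_boot all_order all_algebra.
From mathcomp Require Import reals.

Set Implicit Arguments.
Unset Strict Implicit.
Unset Printing Implicit Defensive.

Import Order.TTheory GRing.Theory Num.Theory.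
Local Open Scope ring_scope.

(** The matrix [A *m delta_mx k l *m B] is column [k] of [A] times row [l] of [B], so every entry of
    [Cmx A B] is a product [A i k * B l j] ([Centry_Cmx]). Summing over one factor isolates the
    other: over [D0 B] the sum of the entries of [B] comes out, and over all [(i, k)] the total mass
    of [A], which is [n]. *)

Lemma Centry_Cmx (R : realType) (n m q p : nat)
    (A : 'M[R]_(n, m)) (B : 'M[R]_(q, p)) k l i j :
  Centry (Cmx A B) k l i j = A i k * B l j.
Proof.
have -> : Centry (Cmx A B) k l i j
          = row (vec_index k l) (Cmx A B) 0 (vec_index i j).
  by rewrite [RHS]mxE.
(* Splitting [delta_mx k l] through the one-element index type ['I_1] exhibits the rank-one product;
   its entries are sums with a single term. *)
rewrite row_Cmx mxE vecE -(mul_delta_mx (0 : 'I_1)) mulmxA -mulmxA.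
by rewrite -colE -rowE mxE big_ord1 !mxE.
Qed.

Theorem corollary2p4 (R : realType) (n m q p T : nat)
  (n_gt0 : (0 < n)%N)
  (A : 'M[R]_(n, m)) (B : 'M[R]_(q, p))
  (A_ge0 : forall i k, 0 <= A i k)
  (A_row : forall i, \sum_k `|A i k| = 1)
  (X : 'I_T -> 'M[R]_(m, q)) (M : 'I_T -> 'M[R]_(n, p))
  (X_span : <<[seq X t | t : 'I_T]>>%VS = fullv)
  (M_def : forall t, M t = A *m X t *m B) :
  (\sum_(d in D0 B) B d.2 d.1 != 0 ->
   forall (i : 'I_n) (k : 'I_m),
     A i k = (\sum_(d in D0 B) Centry (Cmx A B) k d.2 i d.1)
             / (\sum_(d in D0 B) B d.2 d.1))
  /\
  (forall (l : 'I_q) (j : 'I_p),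
     B l j = n%:R^-1 *
       \sum_(f in [set: 'I_n * 'I_m]) Centry (Cmx A B) f.2 l f.1 j).
Proof.
split=> [B_neq0 i k|l j].
  under eq_bigr do rewrite Centry_Cmx.
  (* [B_neq0] permits the cancellation; at a zero denominator the quotient would default to 0. *)
  by rewrite -mulr_sumr mulfK.
(* Nonnegativity turns the norm condition into plain row sums. *)
have A_row1 i : \sum_k A i k = 1.
  by rewrite -[RHS](A_row i); apply: eq_bigr => k _; rewrite ger0_norm.
rewrite (eq_bigl xpredT) => [|f]; last by rewrite inE.
under eq_bigr do rewrite Centry_Cmx.
(* Summing [A] row by row gives [n] ones; [n_gt0] makes [n%:R] invertible. *)
rewrite -mulr_suml -(pair_bigA _ (fun i k => A i k)) /=.
under eq_bigr do rewrite A_row1.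
by rewrite sumr_const card_ord mulKf // pnatr_eq0 -lt0n.
Qed.
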